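(* Let $u^{k+1}=N(u^k,x(D))=u^k+A(u^k,x(D))\,R(u^k,x(D))$ be a fixed point iteration, let $\frac{du^k}{dD}$ be its exact tangent sensitivities, and let $\widetilde{\frac{du^k}{dD}}$ be the approximate tangent sensitivities obtained by linearizing $R$ exactly but $A$ inexactly, as defined in the context. Let $L=L(u,x(D))$ be an objective function evaluated only at the final iterate, whose partial derivatives are computed exactly. Put $$\frac{d\epsilon_u^k}{dD}=\frac{du^k}{dD}-\widetilde{\frac{du^k}{dD}},\qquad \epsilon_L^{k}=\frac{dL}{dD}-\widetilde{\frac{dL}{dD}}\ \text{ (with } L \text{ evaluated at } u^{k}),\qquad B=\frac{\partial N}{\partial u}(u^k,x(D)).$$ Then for every $k\ge 0$, $$\left\|\epsilon_L^{k+1}\right\|\le\left\|\frac{\partial L}{\partial u^{k+1}}\right\|\left[\,\|B\|\left\|\frac{d\epsilon_u^k}{dD}\right\|+\left\|\left[\left(\frac{dA}{dD}-\widetilde{\frac{dA}{dD}}\right)-\left(\frac{\partial A}{\partial u^k}-\widetilde{\frac{\partial A}{\partial u^k}}\right)\frac{d\epsilon_u^k}{dD}\right]R\right\|\,\right],$$ where $A$, $R$ and their exact and approximate derivatives on the right-hand side are evaluated at $(u^k,x(D))$, and where $$\frac{dA}{dD}-\widetilde{\frac{dA}{dD}}:=\left(\frac{\partial A}{\partial x}-\widetilde{\frac{\partial A}{\partial x}}\right)\frac{dx}{dD}+\left(\frac{\partial A}{\partial u^k}-\widetilde{\frac{\partial A}{\partial u^k}}\right)\frac{du^k}{dD}.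$$
   Context: Setting: $u\in\mathbb{R}^n$ is the state (conservative variable) vector, $D\in\mathbb{R}^p$ the design variable vector, $x(D)\in\mathbb{R}^q$ the mesh coordinate vector, $R(u,x)\in\mathbb{R}^n$ the residual operator of a discretized PDE, $A(u,x)\in\mathbb{R}^{n\times n}$ an operator defining the nonlinear solver, and $L(u,x)\in\mathbb{R}$ an objective function; all are differentiable. $\|\cdot\|$ is the 2-norm (the induced 2-norm for matrices). Exact tangent recursion (differentiation of the fixed point iteration with respect to $D$), all quantities evaluated at $(u^k,x(D))$: $$\frac{du^{k+1}}{dD}=\frac{du^k}{dD}+\left[\frac{\partial A}{\partial x}\frac{dx}{dD}+\frac{\partial A}{\partial u^k}\frac{du^k}{dD}\right]R+A\left[\frac{\partial R}{\partial x}\frac{dx}{dD}+\frac{\partial R}{\partial u^k}\frac{du^k}{dD}\right].$$ Approximate tangent recursion: the exact partial derivatives of $A$ are replaced by given approximations $\widetilde{\frac{\partial A}{\partial x}}$, $\widetilde{\frac{\partial A}{\partial u^k}}$ (linear maps of the same type as the exact derivatives), while the partial derivatives of $R$ are exact: $$\widetilde{\frac{du^{k+1}}{dD}}=\widetilde{\frac{du^k}{dD}}+\left[\widetilde{\frac{\partial A}{\partial x}}\frac{dx}{dD}+\widetilde{\frac{\partial A}{\partial u^k}}\widetilde{\frac{du^k}{dD}}\right]R+A\left[\frac{\partial R}{\partial x}\frac{dx}{dD}+\frac{\partial R}{\partial u^k}\widetilde{\frac{du^k}{dD}}\right].$$ The iterates $u^k$ are the same in both recursions. Objective sensitivities at iterate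 $k$: $\frac{dL}{dD}=\frac{\partial L}{\partial x}\frac{dx}{dD}+\frac{\partial L}{\partial u^k}\frac{du^k}{dD}$ and $\widetilde{\frac{dL}{dD}}=\frac{\partial L}{\partial x}\frac{dx}{dD}+\frac{\partial L}{\partial u^k}\widetilde{\frac{du^k}{dD}}$. Tensor convention: a derivative of $A$ in the design direction applied to $R$ is the $n\times p$ matrix whose $j$-th column is (derivative of $A$ in the $j$-th design direction)$\,R$. For example, the $j$-th column of $\left[\frac{\partial A}{\partial u}V\right]R$, for $V\in\mathbb{R}^{n\times p}$ with columns $v_j$, is $\left(\frac{\partial A}{\partial u}[v_j]\right)R$. Accordingly $B=\frac{\partial N}{\partial u}$ is the $n\times n$ matrix acting by $Bv=v+A\frac{\partial R}{\partial u}v+\left(\frac{\partial A}{\partial u}[v]\right)R$. *)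

(* Defs.v *)
From HB Require Import structures.
From mathcomp Require Export all_boot all_order all_algebra.
From mathcomp Require Export all_classical all_reals all_analysis.
From mathcomp Require Import ring.
Export Order.TTheory GRing.Theory Num.Theory numFieldNormedType.Exports.

Set Implicit Arguments.
Unset Strict Implicit.
Unset Printing Implicit Defensive.

Local Open Scope classical_set_scope.
Local Open Scope ring_scope.

Section Norms.
Context {K : realType}.

Definition norm2 n (v : 'cV[K]_n) : K := Num.sqrt (\sum_(i < n) v i 0 ^+ 2).

(* The norm `|M| that MathComp-Analysis puts on 'M[K]_(m, n) is the entrywise
   sup norm; it only serves as the topology in which derivatives are taken. *)
Definition mxnorm2 m n (M : 'M[K]_(m, n)) : K :=
  sup [set norm2 (M *m v) | v in [set v : 'cV[K]_n | norm2 v <= 1]].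

Let sumsq_ge0 n (v : 'cV[K]_n) : 0 <= \sum_(i < n) v i 0 ^+ 2.
Proof. by apply: sumr_ge0 => i _; rewrite sqr_ge0. Qed.

Let CS n (a b : 'I_n -> K) :
  (\sum_i a i * b i) ^+ 2 <= (\sum_i a i ^+ 2) * (\sum_i b i ^+ 2).
Proof.
rewrite -subr_ge0.
have : 0 <= \sum_i \sum_j (a i * b j - a j * b i) ^+ 2.
  by apply: sumr_ge0 => i _; apply: sumr_ge0 => j _; exact: sqr_ge0.
have -> : \sum_i \sum_j (a i * b j - a j * b i) ^+ 2 =
  ((\sum_i a i ^+ 2) * (\sum_i b i ^+ 2) - (\sum_i a i * b i) ^+ 2) *+ 2.
  have e1 : \sum_i \sum_j a i ^+ 2 * b j ^+ 2 = (\sum_i a i ^+ 2) * (\sum_i b i ^+ 2).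
    by rewrite mulr_suml; apply: eq_bigr => i _; rewrite mulr_sumr.
  have e2 : \sum_i \sum_j a j ^+ 2 * b i ^+ 2 = (\sum_i a i ^+ 2) * (\sum_i b i ^+ 2).
    by rewrite exchange_big /= e1.
  have e3 : \sum_i \sum_j (a i * b i) * (a j * b j) = (\sum_i a i * b i) ^+ 2.
    by rewrite expr2 mulr_suml; apply: eq_bigr => i _; rewrite mulr_sumr.
  transitivity (\sum_i \sum_j a i ^+ 2 * b j ^+ 2 + \sum_i \sum_j a j ^+ 2 * b i ^+ 2
      + \sum_i \sum_j - ((a i * b i) * (a j * b j) *+ 2)).
    rewrite -!big_split /=; apply: eq_bigr => i _; rewrite -!big_split /=.
    by apply: eq_bigr => j _; ring.
  have -> : \sum_i \sum_j - ((a i * b i) * (a j * b j) *+ 2) =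
      - ((\sum_i a i * b i) ^+ 2 *+ 2).
    rewrite -e3 -sumrMnl -sumrN; apply: eq_bigr => i _.
    by rewrite -sumrMnl -sumrN.
  by rewrite e1 e2 mulrnBl mulr2n.
by rewrite pmulrn_lge0.
Qed.

Lemma norm2_mulmx_bounded m n (M : 'M[K]_(m, n)) :
  exists2 C, 0 <= C & forall v, norm2 (M *m v) <= C * norm2 v.
Proof.
exists (Num.sqrt (\sum_i \sum_j M i j ^+ 2)); first exact: sqrtr_ge0.
move=> v; rewrite /norm2 -sqrtrM; last first.
  by apply: sumr_ge0 => i _; apply: sumr_ge0 => j _; exact: sqr_ge0.
rewrite ler_wsqrtr// mulr_suml; apply: ler_sum => i _.
by rewrite mxE; exact: CS.
Qed.

Lemma norm2_eq0 n (v : 'cV[K]_n) : (norm2 v == 0) = (v == 0).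
Proof.
apply/idP/eqP => [|->]; last first.
  by rewrite /norm2 big1 ?sqrtr0// => i _; rewrite mxE expr0n.
rewrite sqrtr_eq0 => h; apply/colP => i; rewrite mxE; apply/eqP.
rewrite -sqrf_eq0 eq_le sqr_ge0 andbT (le_trans _ h)//.
by rewrite (bigD1 i)//= lerDl sumr_ge0// => j _; exact: sqr_ge0.
Qed.

Lemma norm20 n : norm2 (0 : 'cV[K]_n) = 0.
Proof. by apply/eqP; rewrite norm2_eq0. Qed.

Lemma norm2Z n (a : K) (v : 'cV[K]_n) : norm2 (a *: v) = `|a| * norm2 v.
Proof.
rewrite /norm2 -sqrtr_sqr -sqrtrM ?sqr_ge0// mulr_sumr; congr Num.sqrt.
by apply: eq_bigr => i _; rewrite mxE exprMn.
Qed.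

Lemma mxnorm2_has_sup m n (M : 'M[K]_(m, n)) :
  has_sup [set norm2 (M *m v) | v in [set v : 'cV[K]_n | norm2 v <= 1]].
Proof.
split.
  exists (norm2 (M *m 0)); exists 0 => //=.
  by rewrite norm20.
have [C C0 hC] := norm2_mulmx_bounded M; exists C => _ [v /= v1 <-].
by rewrite (le_trans (hC v))// ler_piMr.
Qed.

Lemma le_mxnorm2 m n (M : 'M[K]_(m, n)) v :
  norm2 v <= 1 -> norm2 (M *m v) <= mxnorm2 M.
Proof. by move=> v1; apply: (sup_upper_bound (mxnorm2_has_sup M)); exists v. Qed.

Lemma norm2_mulmx m n (M : 'M[K]_(m, n)) v :
  norm2 (M *m v) <= mxnorm2 M * norm2 v.
Proof.
have [->|v0] := eqVneq v 0.
  by rewrite mulmx0 !norm20 mulr0.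
have nv : 0 < norm2 v by rewrite lt_def norm2_eq0 v0 sqrtr_ge0.
rewrite -ler_pdivrMr// mulrC.
have -> : (norm2 v)^-1 * norm2 (M *m v) = norm2 (M *m ((norm2 v)^-1 *: v)).
  by rewrite -scalemxAr norm2Z ger0_norm// invr_ge0 ltW.
apply: le_mxnorm2.
rewrite norm2Z ger0_norm ?mulVf ?norm2_eq0// invr_ge0.
exact: ltW.
Qed.

Lemma mxnorm2_row n (r : 'rV[K]_n) : mxnorm2 r = norm2 r^T.
Proof.
have h v : norm2 (r *m v) <= norm2 r^T * norm2 v.
  rewrite /norm2 big_ord1 -sqrtrM ?sumsq_ge0// ler_wsqrtr// mxE.
  rewrite (le_trans (CS _ _))// le_eqVlt; apply/orP; left; apply/eqP.
  by congr (_ * _); apply: eq_bigr => i _; rewrite mxE.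
apply/eqP; rewrite eq_le; apply/andP; split.
  apply: ge_sup; first by have [] := mxnorm2_has_sup r.
  by move=> _ [v /= v1 <-]; rewrite (le_trans (h v))// ler_piMr// sqrtr_ge0.
have [r0|r0] := eqVneq (norm2 r^T) 0.
  rewrite r0 -(norm20 1) -(mulmx0 _ r); apply: le_mxnorm2.
  by rewrite norm20.
have rp : 0 < norm2 r^T by rewrite lt_def r0 sqrtr_ge0.
rewrite -(ler_pM2r rp) (le_trans _ (norm2_mulmx _ _))// -expr2.
rewrite /norm2 sqr_sqrtr ?sumsq_ge0// big_ord1 sqrtr_sqr mxE.
rewrite (le_trans _ (ler_norm _))//; apply: ler_sum => i _.
by rewrite !mxE expr2.
Qed.

End Norms.

Section Derivatives.
Context {K : realType}.

(* Column-vector convention: (Jmx f z) *m v = 'd f z v.  The library's 'J f z is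
   for row vectors. *)
Definition Jmx m n (f : 'cV[K]_n -> 'cV[K]_m) (z : 'cV[K]_n) : 'M[K]_(m, n) :=
  \matrix_(i, j) 'd f z (delta_mx j 0) i 0.

Definition gradmx n (f : 'cV[K]_n -> K) (z : 'cV[K]_n) : 'rV[K]_n :=
  \row_j 'd f z (delta_mx j 0).

(* A derivative of an n x n matrix in the directions of 'cV_m is a function
   T : 'cV_m -> 'M_n; tcomp T V is its composition with V, and tapply T r is
   the contraction whose j-th column is (T e_j) r. *)
Definition tcomp m n p (T : 'cV[K]_m -> 'M[K]_n) (V : 'M[K]_(m, p)) :
  'cV[K]_p -> 'M[K]_n := fun d => T (V *m d).

Definition tapply n p (T : 'cV[K]_p -> 'M[K]_n) (r : 'cV[K]_n) : 'M[K]_(n, p) :=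
  \matrix_(i, j) (T (delta_mx j 0) *m r) i 0.

Lemma mul_Jmx m n (f : 'cV[K]_n -> 'cV[K]_m) z v : Jmx f z *m v = 'd f z v.
Proof.
have {2}-> : v = \sum_j v j 0 *: delta_mx j 0.
  by rewrite {1}(matrix_sum_delta v); apply: eq_bigr => j _; rewrite big_ord1.
rewrite linear_sum; apply/colP => i; rewrite mxE summxE.
by apply: eq_bigr => j _; rewrite !mxE linearZ !mxE mulrC.
Qed.

Lemma mul_gradmx n (f : 'cV[K]_n -> K) z v : gradmx f z *m v = ('d f z v)%:M.
Proof.
have {2}-> : v = \sum_j v j 0 *: delta_mx j 0.
  by rewrite {1}(matrix_sum_delta v); apply: eq_bigr => j _; rewrite big_ord1.
rewrite linear_sum; apply/matrixP => i j; rewrite !ord1 !mxE eqxx mulr1n.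
by apply: eq_bigr => k _; rewrite !mxE linearZ mulrC.
Qed.

Let differentiable_fst (U V : normedModType K) (z : U * V) :
  differentiable (@fst U V) z.
Proof.
have l : linear (@fst U V) by [].
pose lM := GRing.isLinear.Build _ _ _ _ _ l.
pose L : {linear _ -> _} := HB.pack (@fst U V) lM.
by apply: (@linear_differentiable K _ _ L) => y; exact: cvg_fst.
Qed.

Let differentiable_snd (U V : normedModType K) (z : U * V) :
  differentiable (@snd U V) z.
Proof.
have l : linear (@snd U V) by [].
pose lM := GRing.isLinear.Build _ _ _ _ _ l.
pose L : {linear _ -> _} := HB.pack (@snd U V) lM.
by apply: (@linear_differentiable K _ _ L) => y; exact: cvg_snd.
Qed.

Lemma continuous_mulmx m n p :
  continuous (fun z : 'M[K]_(m, n) * 'M[K]_(n, p) => z.1 *m z.2).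
Proof.
move=> z; apply: differentiable_continuous.
pose F i j k (z : 'M[K]_(m, n) * 'M[K]_(n, p)) := (z.1 i k * z.2 k j) *: delta_mx i j.
have -> : (fun z : 'M[K]_(m, n) * 'M[K]_(n, p) => z.1 *m z.2) =
    \sum_i \sum_j \sum_k F i j k.
  apply/funext => t; rewrite fct_sumE [LHS]matrix_sum_delta.
  apply: eq_bigr => i _; rewrite fct_sumE; apply: eq_bigr => j _.
  by rewrite fct_sumE mxE scaler_suml.
apply: differentiable_sum => i; apply: differentiable_sum => j.
apply: differentiable_sum => k; apply: differentiableZl.
apply: differentiableM.
  apply: (@differentiable_comp _ _ _ _ fst (fun M : 'M[K]_(m, n) => M i k)).
    exact: differentiable_fst.
  exact: differentiable_coord.
apply: (@differentiable_comp _ _ _ _ snd (fun M : 'M[K]_(n, p) => M k j)).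
  exact: differentiable_snd.
exact: differentiable_coord.
Qed.

Lemma diff_partial (U V W : normedModType K) (f : U -> V -> W) u v h :
  differentiable (fun z : U * V => f z.1 z.2) (u, v) ->
  'd (fun z : U * V => f z.1 z.2) (u, v) h =
  'd (f ^~ v) u h.1 + 'd (f u) v h.2.
Proof.
move=> df.
have d1 : 'd (f ^~ v) u =
    'd (fun z : U * V => f z.1 z.2) (u, v) \o (fun h => (h, 0)) :> (U -> W).
  have e : (fun x : U => (x, v)) = (fun x => (id x, cst v x)) by [].
  have -> : f ^~ v = (fun z : U * V => f z.1 z.2) \o (fun x => (x, v)) by [].
  by rewrite diff_comp// e diff_pair// diff_cst diff_val.
have d2 : 'd (f u) v =
    'd (fun z : U * V => f z.1 z.2) (u, v) \o (fun h => (0, h)) :> (V -> W).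
  have e : (fun x : V => (u, x)) = (fun x => (cst u x, id x)) by [].
  have -> : f u = (fun z : U * V => f z.1 z.2) \o (fun x => (u, x)) by [].
  by rewrite diff_comp// e diff_pair// diff_cst diff_val.
rewrite d1 d2 /= -linearD; congr ('d _ _ _); case: h => a b /=.
transitivity ((a + 0, 0 + b) : U * V); last by [].
by rewrite addr0 add0r.
Qed.

Lemma diff_comp2 (T U V W : normedModType K) (F : U -> V -> W)
    (f : T -> U) (g : T -> V) t h :
  differentiable (fun z : U * V => F z.1 z.2) (f t, g t) ->
  differentiable f t -> differentiable g t ->
  'd (fun t => F (f t) (g t)) t h =
  'd (F ^~ (g t)) (f t) ('d f t h) + 'd (F (f t)) (g t) ('d g t h).
Proof.
move=> dF df dg.
have -> : (fun t => F (f t) (g t)) =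
  (fun z : U * V => F z.1 z.2) \o (fun t => (f t, g t)) by [].
rewrite diff_comp//=; last exact: differentiable_pair.
by rewrite diff_pair// diff_partial.
Qed.

Lemma is_diff_mulmx (U : normedModType K) m n p (f : U -> 'M[K]_(m, n))
   (g : U -> 'M[K]_(n, p)) z : differentiable f z -> differentiable g z ->
  is_diff z (fun y => f y *m g y) (fun h => f z *m 'd g z h + 'd f z h *m g z).
Proof.
move=> df dg.
have c := @continuous_mulmx m n p.
have dm := @differentiable_bilin _ _ _ _ (@mulmx K m n p) (f z, g z) c.
have e : (fun y => f y *m g y) =
  (fun q : 'M[K]_(m, n) * 'M[K]_(n, p) => q.1 *m q.2) \o (fun y => (f y, g y)) by [].
rewrite e; apply: DiffDef.
  by apply: differentiable_comp => //; exact: differentiable_pair.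
rewrite diff_comp//; last exact: differentiable_pair.
by rewrite (@diff_bilin _ _ _ _ (@mulmx K m n p) _ c) diff_pair.
Qed.

End Derivatives.

Section FixedPoint.
Context {K : realType} {n p q : nat}.
Variables (A : 'cV[K]_n -> 'cV[K]_q -> 'M[K]_n).
Variables (R : 'cV[K]_n -> 'cV[K]_q -> 'cV[K]_n).
Variables (x : 'cV[K]_p -> 'cV[K]_q) (u0 : 'cV[K]_p -> 'cV[K]_n).

Definition Nfix (u : 'cV[K]_n) (y : 'cV[K]_q) : 'cV[K]_n := u + A u y *m R u y.

Fixpoint iterate (k : nat) (D : 'cV[K]_p) : 'cV[K]_n :=
  if k is k'.+1 then Nfix (iterate k' D) (x D) else u0 D.

(* Tangent recursion in which the partial derivatives of A at iteration k are
   replaced by dAx k and dAu k, and the residual is linearized exactly; V0 is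
   the sensitivity of the initial iterate. *)
Fixpoint tangent
    (dAx : nat -> 'cV[K]_n -> 'cV[K]_q -> 'cV[K]_q -> 'M[K]_n)
    (dAu : nat -> 'cV[K]_n -> 'cV[K]_q -> 'cV[K]_n -> 'M[K]_n)
    (V0 : 'M[K]_(n, p)) (D : 'cV[K]_p) (k : nat) : 'M[K]_(n, p) :=
  if k is k'.+1 then
    let u := iterate k' D in
    let V := tangent dAx dAu V0 D k' in
    V + tapply (tcomp (dAx k' u (x D)) (Jmx x D) \+ tcomp (dAu k' u (x D)) V)
          (R u (x D))
      + A u (x D) *m (Jmx (R u) (x D) *m Jmx x D + Jmx (R ^~ (x D)) u *m V)
  else V0.

Definition exact_tangent : 'cV[K]_p -> nat -> 'M[K]_(n, p) := fun D =>
  tangent (fun _ u y => 'd (A u) y) (fun _ u y => 'd (A ^~ y) u) (Jmx u0 D) D.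

(* dL/dD at (u, x D) when du/dD is taken to be V. *)
Definition sensitivity (L : 'cV[K]_n -> 'cV[K]_q -> K)
    (u : 'cV[K]_n) (D : 'cV[K]_p) (V : 'M[K]_(n, p)) : 'rV[K]_p :=
  gradmx (L u) (x D) *m Jmx x D + gradmx (L ^~ (x D)) u *m V.

End FixedPoint.

Section FixedPointLemmas.
Context {K : realType} {n p q : nat}.
Variables (A : 'cV[K]_n -> 'cV[K]_q -> 'M[K]_n).
Variables (R : 'cV[K]_n -> 'cV[K]_q -> 'cV[K]_n).
Hypothesis diffA :
  forall z, differentiable (fun z : 'cV[K]_n * 'cV[K]_q => A z.1 z.2) z.
Hypothesis diffR :
  forall z, differentiable (fun z : 'cV[K]_n * 'cV[K]_q => R z.1 z.2) z.

Lemma is_diff_Nfix (f : 'cV[K]_p -> 'cV[K]_n) (x : 'cV[K]_p -> 'cV[K]_q) D :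
  differentiable f D -> differentiable x D ->
  let u := f D in let y := x D in
  is_diff D (fun D => Nfix A R (f D) (x D)) (fun h =>
    'd f D h + (A u y *m ('d (R ^~ y) u ('d f D h) + 'd (R u) y ('d x D h))
      + ('d (A ^~ y) u ('d f D h) + 'd (A u) y ('d x D h)) *m R u y)).
Proof.
move=> df dx u y.
have dp : differentiable (fun D => (f D, x D)) D by exact: differentiable_pair.
pose a D := A (f D) (x D).
pose r D := R (f D) (x D).
have da : differentiable a D.
  exact: (@differentiable_comp _ _ _ _ _ (fun z => A z.1 z.2) D dp).
have dr : differentiable r D.
  exact: (@differentiable_comp _ _ _ _ _ (fun z => R z.1 z.2) D dp).
have dI := DiffDef (Phantom _ _) df (erefl ('d f D : _ -> _)).
apply: is_diff_eq (is_diffD dI (is_diff_mulmx da dr)) _; apply/funext => h.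
have ea := @diff_comp2 _ _ _ _ _ A f x D h (diffA _) df dx.
have er := @diff_comp2 _ _ _ _ _ R f x D h (diffR _) df dx.
transitivity ('d f D h + (a D *m 'd r D h + 'd a D h *m r D)); first by [].
congr (_ + (_ + _)); first exact (congr1 (mulmx (a D)) er).
exact (congr1 (mulmx^~ (r D)) ea).
Qed.

Variables (x : 'cV[K]_p -> 'cV[K]_q) (u0 : 'cV[K]_p -> 'cV[K]_n).
Hypothesis diffx : forall D, differentiable x D.
Hypothesis diffu0 : forall D, differentiable u0 D.

Lemma differentiable_iterate k D : differentiable (iterate A R x u0 k) D.
Proof.
elim: k => [|k IH]; first exact: diffu0.
have [dd _] := is_diff_Nfix IH (diffx D).
exact dd.
Qed.

Lemma exact_tangentE D k :
  exact_tangent A R x u0 D k = Jmx (iterate A R x u0 k) D.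
Proof.
elim: k => [//|k IH].
have [_] := is_diff_Nfix (differentiable_iterate k D) (diffx D).
have -> : exact_tangent A R x u0 D k.+1 =
  let u := iterate A R x u0 k D in let V := exact_tangent A R x u0 D k in
  V + tapply (tcomp ('d (A u) (x D)) (Jmx x D) \+ tcomp ('d (A ^~ (x D)) u) V)
          (R u (x D))
      + A u (x D) *m (Jmx (R u) (x D) *m Jmx x D + Jmx (R ^~ (x D)) u *m V).
  by [].
rewrite IH /=.
move: (iterate A R x u0 k) => f e.
have colE' (M N : 'M[K]_(n, p)) :
    (forall j, M *m (delta_mx j 0 : 'cV_p) = N *m delta_mx j 0) -> M = N.
  by move=> h; apply/matrixP => i j; have /colP/(_ i) := h j; rewrite -!colE !mxE.
apply: colE' => j; rewrite mul_Jmx e.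
rewrite !mulmxDl -!mulmxA mulmxDl -!mulmxA !mul_Jmx -addrA; congr (_ + _).
rewrite addrC [X in A _ _ *m X]addrC; congr (_ + _).
apply/colP => i; rewrite -colE !mxE /= /tcomp !mul_Jmx -big_split /=.
by apply: eq_bigr => l _; rewrite mxE addrC mulrDl.
Qed.

End FixedPointLemmas.

(* Main.v *)
Require Import Defs.
From mathcomp Require Import ring.

(* By linearity the tangent error satisfies
     eps_u (k+1) = B eps_u k + [errAx dx/dD + errAu V~] R,
   where V~ is the approximate tangent: the exact linearization of R contributes
   only through eps_u k, and dA/du V - (dA/du)~ V~ = dA/du eps_u k + errAu V~.
   Writing V~ = du/dD - eps_u k gives the bracket of the bound.  Since the
   partial derivatives of L are exact, eps_L = dL/du eps_u, and norms conclude. *)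

Set Implicit Arguments.
Unset Strict Implicit.
Unset Printing Implicit Defensive.

Local Open Scope classical_set_scope.
Local Open Scope ring_scope.

Section Norms.
Context {K : realType}.

Lemma norm2_ge0 n (v : 'cV[K]_n) : 0 <= norm2 v.
Proof. exact: sqrtr_ge0. Qed.

Lemma sqr_norm2 n (v : 'cV[K]_n) : norm2 v ^+ 2 = (v^T *m v) 0 0.
Proof.
rewrite sqr_sqrtr; last by apply: sumr_ge0 => i _; exact: sqr_ge0.
by rewrite mxE; apply: eq_bigr => i _; rewrite mxE expr2.
Qed.

(** The row [v^T] has induced norm [norm2 v], so this is the operator norm bound for [v^T] applied
    to [w]. *)
Lemma cauchy_schwarz_norm2 n (v w : 'cV[K]_n) :
  (v^T *m w) 0 0 <= norm2 v * norm2 w.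
Proof.
have := norm2_mulmx v^T w; rewrite mxnorm2_row trmxK; apply: le_trans.
by rewrite {1}/norm2 big_ord1 sqrtr_sqr ler_norm.
Qed.

(** Split the square of [norm2 (v + w)] as the products of [v + w] with [v] and with [w], apply
    Cauchy-Schwarz to each, and cancel the factor [norm2 (v + w)] when it is nonzero. *)
Lemma norm2D n (v w : 'cV[K]_n) : norm2 (v + w) <= norm2 v + norm2 w.
Proof.
have [->|vw0] := eqVneq (norm2 (v + w)) 0; first by rewrite addr_ge0// norm2_ge0.
have vw_gt0 : 0 < norm2 (v + w) by rewrite lt_def vw0 norm2_ge0.
rewrite -(ler_pM2l vw_gt0) -expr2 sqr_norm2 mulmxDr mxE mulrDr.
by rewrite lerD// cauchy_schwarz_norm2.
Qed.

Lemma mxnorm2_ge0 m n (M : 'M[K]_(m, n)) : 0 <= mxnorm2 M.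
Proof.
apply: (le_trans (norm2_ge0 (M *m 0))); apply: le_mxnorm2.
by rewrite norm20.
Qed.

Lemma mxnorm2_le m n (M : 'M[K]_(m, n)) C :
  (forall v, norm2 v <= 1 -> norm2 (M *m v) <= C) -> mxnorm2 M <= C.
Proof.
move=> MC; apply: ge_sup; first by have [] := mxnorm2_has_sup M.
by move=> _ [v /= v1 <-]; exact: MC.
Qed.

Lemma mxnorm2D m n (M N : 'M[K]_(m, n)) :
  mxnorm2 (M + N) <= mxnorm2 M + mxnorm2 N.
Proof.
apply: mxnorm2_le => v v1.
by rewrite mulmxDl (le_trans (norm2D _ _))// lerD// le_mxnorm2.
Qed.

Lemma mxnorm2M m n p (M : 'M[K]_(m, n)) (N : 'M[K]_(n, p)) :
  mxnorm2 (M *m N) <= mxnorm2 M * mxnorm2 N.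
Proof.
apply: mxnorm2_le => v v1.
rewrite -mulmxA (le_trans (norm2_mulmx _ _))// ler_wpM2l ?mxnorm2_ge0//.
exact: le_mxnorm2.
Qed.

End Norms.

Section Tensors.
Context {K : realType} {n p : nat}.
Implicit Types (S T : 'cV[K]_p -> 'M[K]_n) (r : 'cV[K]_n).

Lemma tapplyD S T r : tapply (S \+ T) r = tapply S r + tapply T r.
Proof.
apply/matrixP => i j; rewrite !mxE -big_split.
by apply: eq_bigr => l _; rewrite mxE mulrDl.
Qed.

Lemma tapplyB S T r : tapply (S \- T) r = tapply S r - tapply T r.
Proof.
apply/matrixP => i j; rewrite !mxE -sumrB.
by apply: eq_bigr => l _; rewrite !mxE mulrBl.
Qed.

(** Writing W = V - (V - W) gives T V - T' W = T (V - W) + (T - T') V - (T - T') (V - W). In the use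
    below, [S] and [S'] are the exact and approximate mesh terms. *)
Lemma tapply_tcompB m (T T' : {linear 'cV[K]_m -> 'M[K]_n}) S S'
    (V W : 'M[K]_(m, p)) r :
  tapply (S \+ tcomp T V) r - tapply (S' \+ tcomp T' W) r =
  tapply (tcomp T (V - W)) r +
  tapply (((S \- S') \+ tcomp (T \- T') V) \- tcomp (T \- T') (V - W)) r.
Proof.
rewrite -tapplyB -tapplyD; congr tapply; apply/funext => d.
rewrite /tcomp /= mulmxBl (linearB T) (linearB T').
by apply/matrixP => i j; rewrite !mxE; ring.
Qed.

End Tensors.

Section Nfix.
Context {K : realType} {n p q : nat}.
Variables (A : 'cV[K]_n -> 'cV[K]_q -> 'M[K]_n).
Variables (R : 'cV[K]_n -> 'cV[K]_q -> 'cV[K]_n).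
Hypothesis diffA :
  forall z, differentiable (fun z : 'cV[K]_n * 'cV[K]_q => A z.1 z.2) z.
Hypothesis diffR :
  forall z, differentiable (fun z : 'cV[K]_n * 'cV[K]_q => R z.1 z.2) z.
Variables (u : 'cV[K]_n) (y : 'cV[K]_q).

Lemma diff_Nfix h :
  'd ((Nfix A R)^~ y) u h =
  h + (A u y *m 'd (R^~ y) u h + 'd (A^~ y) u h *m R u y).
Proof.
(* Joint differentiability passes to the partial maps through v -> (v, y); the product rule then
   applies. *)
have dp : differentiable (fun v : 'cV[K]_n => (v, y)) u.
  by apply: differentiable_pair; [exact: ex_diff | exact: differentiable_cst].
have dA : differentiable (A^~ y) u.
  exact: (@differentiable_comp _ _ _ _ _ (fun z => A z.1 z.2) u dp).
have dR : differentiable (R^~ y) u.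
  exact: (@differentiable_comp _ _ _ _ _ (fun z => R z.1 z.2) u dp).
have dN := is_diffD (is_diff_id u) (is_diff_mulmx dA dR).
exact: (congr1 (@^~ h) (@diff_val _ _ _ _ _ _ _ dN)).
Qed.

(** The action of B on a matrix of directions, arranged like the tangent recursion. It is checked
    columnwise: column j is the derivative of N in the direction [V *m delta_mx j 0]. *)
Lemma mul_Jmx_Nfix (V : 'M[K]_(n, p)) :
  Jmx ((Nfix A R)^~ y) u *m V =
  V + tapply (tcomp ('d (A^~ y) u) V) (R u y) + A u y *m (Jmx (R^~ y) u *m V).
Proof.
apply/matrixP => i j.
have entry (M : 'M[K]_(n, p)) : M i j = (M *m (delta_mx j 0 : 'cV_p)) i 0.
  by rewrite -colE mxE.
rewrite entry -mulmxA mul_Jmx diff_Nfix -mul_Jmx !mulmxA.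
rewrite mxE -entry [X in _ + X]mxE -entry.
by rewrite [RHS]mxE [X in _ = X + _]mxE [tapply _ _ i j]mxE
  [X in _ + X]addrC addrA.
Qed.

End Nfix.

Theorem proposition1 (K : realType) (n p q : nat)
  (A : 'cV[K]_n -> 'cV[K]_q -> 'M[K]_n)
  (R : 'cV[K]_n -> 'cV[K]_q -> 'cV[K]_n)
  (L : 'cV[K]_n -> 'cV[K]_q -> K)
  (x : 'cV[K]_p -> 'cV[K]_q)
  (u0 : 'cV[K]_p -> 'cV[K]_n)
  (diffA : forall z, differentiable (fun z : 'cV[K]_n * 'cV[K]_q => A z.1 z.2) z)
  (diffR : forall z, differentiable (fun z : 'cV[K]_n * 'cV[K]_q => R z.1 z.2) z)
  (diffL : forall z, differentiable (fun z : 'cV[K]_n * 'cV[K]_q => L z.1 z.2) z)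
  (diffx : forall D, differentiable x D)
  (diffu0 : forall D, differentiable u0 D)
  (D : 'cV[K]_p)
  (Atx : nat -> 'cV[K]_n -> 'cV[K]_q -> {linear 'cV[K]_q -> 'M[K]_n})
  (Atu : nat -> 'cV[K]_n -> 'cV[K]_q -> {linear 'cV[K]_n -> 'M[K]_n})
  (V0 : 'M[K]_(n, p))
  (k : nat) :
  let u := fun i => iterate A R x u0 i D in
  let dudD := exact_tangent A R x u0 D in
  let dudD_apx := tangent A R x u0 Atx Atu V0 D in
  let eps_u := fun i => dudD i - dudD_apx i in
  let eps_L := fun i =>
    sensitivity x L (u i) D (dudD i) - sensitivity x L (u i) D (dudD_apx i) in
  let B := Jmx ((Nfix A R) ^~ (x D)) (u k) in
  let errAx := 'd (A (u k)) (x D) \- Atx k (u k) (x D) in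
  let errAu := 'd (A ^~ (x D)) (u k) \- Atu k (u k) (x D) in
  let errAD := tcomp errAx (Jmx x D) \+ tcomp errAu (dudD k) in
  is_true (mxnorm2 (eps_L k.+1) <=
    mxnorm2 (gradmx (L ^~ (x D)) (u k.+1)) *
    (mxnorm2 B * mxnorm2 (eps_u k) +
     mxnorm2 (tapply (errAD \- tcomp errAu (eps_u k)) (R (u k) (x D))))).
Proof.
move=> u dudD dudD_apx eps_u eps_L B errAx errAu errAD.
have eps_uS : eps_u k.+1 = B *m eps_u k +
    tapply (errAD \- tcomp errAu (eps_u k)) (R (u k) (x D)).
  (* The [tapply] term of B is brought next to the bracket; together they are the difference of the
     exact and approximate [tapply] terms. *)
  rewrite (mul_Jmx_Nfix diffA diffR) addrAC -[X in X + _]addrA.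
  rewrite -[X in _ + X + _](tapply_tcompB _ _
    (tcomp ('d (A (u k)) (x D)) (Jmx x D)) (tcomp (Atx k (u k) (x D)) (Jmx x D))).
  (* The mesh part of the linearized residual is common to both recursions, so it can be added and
     subtracted. *)
  have residualB : Jmx (R^~ (x D)) (u k) *m eps_u k =
      Jmx (R (u k)) (x D) *m Jmx x D + Jmx (R^~ (x D)) (u k) *m dudD k -
      (Jmx (R (u k)) (x D) *m Jmx x D + Jmx (R^~ (x D)) (u k) *m dudD_apx k).
    by rewrite mulmxBr opprD addrACA subrr add0r.
  rewrite residualB mulmxBr -[eps_u k]/(dudD k - dudD_apx k).
  by rewrite (addrACA (dudD k)) -opprD addrACA -opprD.
(* The mesh term of the sensitivity cancels, being the same for both tangents. *)
have -> : eps_L k.+1 = gradmx (L^~ (x D)) (u k.+1) *m eps_u k.+1.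
  by rewrite /eps_L /sensitivity opprD addrACA subrr add0r -mulmxBr.
rewrite (le_trans (mxnorm2M _ _))// ler_wpM2l ?mxnorm2_ge0// eps_uS.
by rewrite (le_trans (mxnorm2D _ _))// lerD2r mxnorm2M.
Qed.
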